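(* Let $L$ be a positive-definite even lattice with $\Phi(L)\ne\emptyset$, and let $V_P$ (resp. $V_B$) be a parabolic-type (resp. Borel-type) subVOA of the lattice VOA $V_L$. Then $\mathfrak{p}=(V_P)_1$ (resp. $\mathfrak{b}=(V_B)_1$) is a parabolic (resp. Borel) subalgebra of the reductive Lie algebra $\mathfrak{g}=(V_L)_1$.
   Context: $L$ is a positive-definite even lattice spanned over $\mathbb{Z}$ by an $\mathbb{R}$-basis of a Euclidean space $(E,(\cdot|\cdot))$; $\Phi(L)=\{\alpha\in L:(\alpha|\alpha)=2\}$ is the set of roots of $L$. For $0\ne\gamma\in E$ put $P(\gamma)=\{v\in E:(\gamma|v)=0\}$ and $P^{\ge0}(\gamma)=\{v\in E:(\gamma|v)\ge0\}$. A submonoid of $L$ is a subset containing $0$ and closed under addition. A submonoid $B\le L$ is of Borel-type if $B\cup(-B)=L$, $B\cap(-B)=\{0\}$, and there is a hyperplane $P(\gamma)\subset E$ with $B\subset P^{\ge0}(\gamma)$. A submonoid $P\le L$ is of parabolic-type if it contains a Borel-type submonoid. Lattice VOA. Put $\mathfrak{h}=\mathbb{C}\otimes_{\mathbb{Z}}L$ with the $\mathbb{C}$-bilinear extension of $(\cdot|\cdot)$, and $\hat{\mathfrak{h}}=\mathfrak{h}\otimes\mathbb{C}[t,t^{-1}]\oplus\mathbb{C}K$ with $K$ central, $h(m)=h\otimes t^m$, $[h_1(m),h_2(n)]=m\delta_{m+n,0}(h_1|h_2)K$. For $\lambda\in\mathfrak{h}$, $M_{\hat{\mathfrak{h}}}(1,\lambda)=U(\hat{\mathfrak{h}})\otimes_{U(\hat{\mathfrak{h}}_{\ge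 0})}\mathbb{C}e^\lambda$, where $\hat{\mathfrak{h}}_{\ge 0}=\mathfrak{h}\otimes\mathbb{C}[t]\oplus\mathbb{C}K$ acts by $K=1$, $h(0)e^\lambda=(h|\lambda)e^\lambda$, $h(n)e^\lambda=0$ for $n>0$. Let $\epsilon:L\times L\to\{\pm1\}$ be a 2-cocycle with $\epsilon(\alpha,\beta)\epsilon(\beta,\alpha)=(-1)^{(\alpha|\beta)}$ and $\epsilon(0,\alpha)=\epsilon(\alpha,0)=1$. The lattice VOA is $V_L=\bigoplus_{\alpha\in L}M_{\hat{\mathfrak{h}}}(1,\alpha)=M_{\hat{\mathfrak{h}}}(1,0)\otimes\mathbb{C}^\epsilon[L]$ with vacuum $\mathbf{1}=e^0$, $Y(h(-1)\mathbf{1},z)=\sum_{n}h(n)z^{-n-1}$, $Y(e^\alpha,z)=\exp\big(\sum_{n>0}\frac{\alpha(-n)}{n}z^n\big)\exp\big(-\sum_{n>0}\frac{\alpha(n)}{n}z^{-n}\big)e_\alpha z^\alpha$, where $e_\alpha(w\otimes e^\beta)=\epsilon(\alpha,\beta)w\otimes e^{\alpha+\beta}$ and $z^\alpha$ acts on $M_{\hat{\mathfrak{h}}}(1,\beta)$ as $z^{(\alpha|\beta)}$; $Y$ of a general $h_1(-n_1-1)\cdots h_k(-n_k-1)e^\alpha$ is the normally ordered product of the $\frac{1}{n_i!}\partial_z^{n_i}h_i(z)$ and $Y(e^\alpha,z)$. The weight of $h_1(-n_1)\cdots h_k(-n_k)e^\alpha$ is $n_1+\cdots+n_k+(\alpha|\alpha)/2$;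 for a subVOA $V$, $V_1$ denotes its weight-one subspace. For a submonoid $M\le L$, $V_M=\bigoplus_{\gamma\in M}M_{\hat{\mathfrak{h}}}(1,\gamma)$ is a subVOA of $V_L$. $V_B$ (resp. $V_P$) with $B$ of Borel-type (resp. $P$ of parabolic-type) is called a Borel-type (resp. parabolic-type) subVOA. For a CFT-type VOA $V$, $V_1$ is a Lie algebra with bracket $[a,b]=a_0b=\mathrm{Res}_zY(a,z)b$. For $V_L$ the Lie algebra $(V_L)_1=\mathfrak{h}+\sum_{\alpha\in\Phi(L)}\mathbb{C}e^\alpha$ (with $\mathfrak{h}$ identified with $\{h(-1)\mathbf{1}\}$) is reductive. A parabolic subalgebra is one that contains a Borel (maximal solvable) subalgebra. *)

(* Defs.v *)
From HB Require Import structures.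
From mathcomp Require Import all_boot all_order all_algebra sesquilinear.
From mathcomp Require Import finmap multiset.
From mathcomp Require Import boolp classical_sets functions fsbigop reals.
From mathcomp Require Import complex.
From mathcomp Require Import monalg.

Set Implicit Arguments.
Unset Strict Implicit.
Unset Printing Implicit Defensive.

Import Order.TTheory GRing.Theory Num.Theory.

Local Open Scope classical_set_scope.
Local Open Scope ring_scope.
Local Open Scope complex_scope.

Section LieSubalgebras.
Context {K : fieldType} {V : lmodType K}.
Variable br : V -> V -> V.

Definition is_subspace (S : set V) : Prop :=
  S 0 /\ forall (c : K) (u v : V), S u -> S v -> S (c *: u + v).

Definition linear_span (A : set V) : set V :=
  [set v | forall S, is_subspace S -> A `<=` S -> S v].

Definition is_subalgebra (g s : set V) : Prop :=
  [/\ s `<=` g, is_subspace s & forall u v, s u -> s v -> s (br u v)].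

Definition derived_algebra (s : set V) : set V :=
  linear_span [set w | exists u v, [/\ s u, s v & w = br u v]].

Definition is_solvable (s : set V) : Prop :=
  exists k : nat, iter k derived_algebra s `<=` [set 0].

Definition is_borel_subalgebra (g s : set V) : Prop :=
  [/\ is_subalgebra g s, is_solvable s &
      forall t, is_subalgebra g t -> is_solvable t -> s `<=` t -> t = s].

Definition is_parabolic_subalgebra (g s : set V) : Prop :=
  is_subalgebra g s /\ exists2 t, is_borel_subalgebra g t & t `<=` s.

End LieSubalgebras.

(* [F : fdist V] stands for the series [\sum_(m : int) F m z^m] with
  coefficients operators on [V].  The sums below range over infinite sets of
  indices; [\sum_(i \in A) F i] is the sum of a finitely supported family.  For
  the fields of the lattice vertex algebra, only finitely many terms are nonzero
  once the series is applied to a fixed vector. *)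

Section FormalDistributions.
Context {K : fieldType} {V : lmodType K}.

Definition fdist := int -> V -> V.

Definition fd_one : fdist := fun m w => if m == 0 then w else 0.

Definition fd_mul (F G : fdist) : fdist :=
  fun m w => \sum_(j \in [set: int]) F (m - j) (G j w).

Definition fd_exp (F : fdist) : fdist := fun m w =>
  \sum_(k \in [set: nat]) (k`!%:R : K)^-1 *: iter k (fd_mul F) fd_one m w.

Definition fd_deriv (F : fdist) : fdist :=
  fun m w => ((m + 1)%:~R : K) *: F (m + 1) w.

Definition fd_divderiv (k : nat) (F : fdist) : fdist :=
  fun m w => (k`!%:R : K)^-1 *: iter k fd_deriv F m w.

(* :F(z)G(z): = F(z)_+ G(z) + G(z) F(z)_-, where F(z)_+ collects the nonnegative
   powers of z.  For F = h(z), the part F(z)_- contains h(n) for all n >= 0, so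
   h(0) too is moved to the right. *)
Definition fd_nop (F G : fdist) : fdist := fun m w =>
  \sum_(j \in [set j : int | 0 <= j]) F j (G (m - j) w)
  + \sum_(j \in [set j : int | j < 0]) G (m - j) (F j w).

End FormalDistributions.
Arguments fdist {K} V.

(* The lattice L spanned over the integers by the basis [b] is represented by its
  coordinates: [x : 'rV[int]_n] stands for [latvec b x]. *)

Section Lattice.
Context {R : realType} {E : vectType R} (ip : {dot E for @idfun R}).
Context {n : nat} (b : n.-tuple E).

Definition latvec (x : 'rV[int]_n) : E := \sum_(i < n) tnth b i *~ x 0 i.

Definition lip (x y : 'rV[int]_n) : R := ip (latvec x) (latvec y).

Definition even_lattice : Prop := forall x, exists k : int, lip x x = (2 * k)%:~R.

Definition lattice_roots : set 'rV[int]_n := [set x | lip x x = 2].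

Definition is_submonoid (M : set 'rV[int]_n) : Prop :=
  M 0 /\ forall x y, M x -> M y -> M (x + y).

Definition borel_type (B : set 'rV[int]_n) : Prop :=
  [/\ is_submonoid B,
      B `|` [set - x | x in B] = [set: 'rV[int]_n],
      B `&` [set - x | x in B] = [set 0] &
      exists2 gamma : E, gamma != 0 & forall x, B x -> 0 <= ip gamma (latvec x)].

Definition parabolic_type (P : set 'rV[int]_n) : Prop :=
  is_submonoid P /\ exists2 B, borel_type B & B `<=` P.

Definition lattice_cocycle (eps : 'rV[int]_n -> 'rV[int]_n -> int) : Prop :=
  [/\ forall x y, eps x y = 1 \/ eps x y = -1,
      forall x y z, eps x y * eps (x + y) z = eps y z * eps x (y + z),
      forall x y (m : int), lip x y = m%:~R -> eps x y * eps y x = (-1) ^ m &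
      forall x, eps 0 x = 1 /\ eps x 0 = 1].

End Lattice.

Section LatticeVOA.
Context {R : realType} {E : vectType R} (ip : {dot E for @idfun R}).
Context {n : nat} (b : n.-tuple E) (eps : 'rV[int]_n -> 'rV[int]_n -> int).

Local Notation C := R[i].

(* Elements of h = C (x) L are given by their coordinates in the basis b. *)
Definition cip (h k : 'rV[C]_n) : C :=
  \sum_(i < n) \sum_(j < n) h 0 i * k 0 j * (ip (tnth b i) (tnth b j))%:C.

Definition cvec (x : 'rV[int]_n) : 'rV[C]_n := map_mx intr x.

(* By PBW, V_L has as a C-basis the vectors
   b_(i_1)(-p_1-1) ... b_(i_k)(-p_k-1) e^x, indexed by the multiset of the pairs
   (p_j, i_j) and by x in L. *)
Definition fock_basis : choiceType := ({mset nat * 'I_n}%mset * 'rV[int]_n)%type.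

Definition lattice_voa : lmodType C := {malg C[fock_basis]}.

Local Notation VL := lattice_voa.

Definition lin_extend (f : fock_basis -> VL) (v : VL) : VL :=
  \sum_(k <- msupp v) v@_k *: f k.

(* The operator h(m): h(-p-1) multiplies by h(-p-1), and h(p+1) is the derivation
   with h(p+1) . b_i(-p-1) = (p+1) (h|b_i). *)
Definition heis (h : 'rV[C]_n) (m : int) : VL -> VL :=
  match m with
  | Negz p => lin_extend (fun k =>
      \sum_(i < n) h 0 i *: << ((p, i) +` k.1, k.2)%mset >>)
  | Posz 0 => lin_extend (fun k => cip h (cvec k.2) *: << k >>)
  | Posz p.+1 => lin_extend (fun k =>
      \sum_(i < n) (p.+1%:R * cip h (delta_mx 0 i) * (k.1 (p, i))%:R)
         *: << (k.1 `\ (p, i), k.2)%mset >>)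
  end.

(* h(z) = \sum_m h(m) z^(-m-1) *)
Definition heis_field (h : 'rV[C]_n) : fdist VL := fun m => heis h (- m - 1).

Definition creation_exponent (h : 'rV[C]_n) : fdist VL := fun m w =>
  if 0 < m then (m%:~R)^-1 *: heis h (- m) w else 0.

Definition annihilation_exponent (h : 'rV[C]_n) : fdist VL := fun m w =>
  if m < 0 then - (((- m)%:~R)^-1 *: heis h (- m) w) else 0.

Definition shift_op (x : 'rV[int]_n) : VL -> VL :=
  lin_extend (fun k => (eps x k.2)%:~R *: << (k.1, x + k.2) >>).

Definition zpow_op (x : 'rV[int]_n) : fdist VL := fun m =>
  lin_extend (fun k => if lip ip b x k.2 == m%:~R then << k >> else 0).

Definition exp_vertex (x : 'rV[int]_n) : fdist VL :=
  fd_mul (fd_exp (creation_exponent (cvec x)))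
    (fd_mul (fd_exp (annihilation_exponent (cvec x)))
       (fun m w => shift_op x (zpow_op x m w))).

(* The factors are taken in the order of enumeration of the multiset; the result
   does not depend on it. *)
Definition basis_vertex (k : fock_basis) : fdist VL :=
  foldr (fun (y : nat * 'I_n) F =>
           fd_nop (fd_divderiv y.1 (heis_field (delta_mx 0 y.2))) F)
        (exp_vertex k.2) (enum_mset k.1).

(* [vertex_op v m] is the coefficient of z^m in Y(v, z). *)
Definition vertex_op (v : VL) : fdist VL :=
  fun m w => \sum_(k <- msupp v) v@_k *: basis_vertex k m w.

(* u_0 v = Res_z Y(u, z) v *)
Definition zero_bracket (u v : VL) : VL := vertex_op u (-1) v.

Definition fock_weight (k : fock_basis) : R :=
  \sum_(y <- enum_mset k.1) (y.1.+1)%:R + lip ip b k.2 k.2 / 2.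

Definition sub_voa (M : set 'rV[int]_n) : set VL :=
  [set v | forall k, k \in msupp v -> M k.2].

Definition weight_one (W : set VL) : set VL :=
  [set v | W v /\ forall k, k \in msupp v -> fock_weight k = 1].

End LatticeVOA.

(* Main.v *)
Require Import Defs.
From HB Require Import structures.
From mathcomp Require Import all_boot all_order all_algebra sesquilinear.
From mathcomp Require Import finmap multiset.
From mathcomp Require Import boolp classical_sets functions fsbigop reals.
From mathcomp Require Import complex monalg.
From mathcomp Require Import zify ring lra.

(** The weight-one space has as basis the vectors [h_i = b_i(-1) e^0] and the
    [e^x] with [x] a root ([weight_one_key]), and its bracket is the familiar
    one of a reductive Lie algebra:
    [[h_i, e^x] = (b_i|x) e^x], while [[e^x, e^y]] is a multiple of [e^(x+y)]
    when [(x|y) = -1], a multiple of the coroot [x(-1) e^0] when [y = -x], and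
    zero otherwise.  In particular it is graded by the lattice
    ([bracket_graded]), so a submonoid [M] yields a subalgebra.

    The bracket is defined through infinite sums of composed operators, whose
    linearity is not formal.  The sums collapse, however, on a whole
    weight-one vector [v]: there [(e^x)_0 v] is the explicit linear expression
    [exp_vertex_weight_one], because the annihilation exponential of [x] stops
    after its linear term and, by the Cauchy-Schwarz inequality, [z^x] only
    produces exponents at least [-2].  Bilinearity and the table of brackets
    both follow from it.

    Let [B] be of Borel type; it is the positive cone of a total order on the
    lattice.
    - Solvability ([borel_solvable]).  The derived algebra has no Cartan
      component, since two elements of [B] with zero sum vanish.  On what
      remains, brackets strictly increase the number of roots below the degree
      in the order of [B].  This number is bounded, because there are finitely
      many roots: they stay distinct modulo 3 ([root_mod3_inj]).
    - Maximality ([borel_sub_voa_borel]).  A strictly larger subalgebra contains a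
      vector with a component outside [B].  The Cartan vectors separate the weights,
      so it contains the corresponding [e^(-x)] itself with [x] in [B]
      ([isolate_root_vector]).  Together with [e^x] this spans a copy of
      [sl_2], which is perfect ([not_solvable_sl2]).

    For a parabolic-type [P] containing [B], the subalgebra attached to [P]
    contains the Borel subalgebra attached to [B]. *)

Import Order.TTheory GRing.Theory Num.Theory.

Local Open Scope classical_set_scope.
Local Open Scope ring_scope.
Local Open Scope complex_scope.

Arguments heis : simpl never.

(** * The integral form of the lattice *)

Section LatticeForm.
Context {R : realType} {E : vectType R} (ip : {dot E for @idfun R}).
Context {n : nat} (b : n.-tuple E).

Local Notation latvec := (latvec b).
Local Notation lip := (lip ip b).

Lemma latvecD x y : latvec (x + y) = latvec x + latvec y.
Proof.
by rewrite /Defs.latvec -big_split; apply: eq_bigr => i _; rewrite mxE mulrzDr.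
Qed.

Lemma latvecN x : latvec (- x) = - latvec x.
Proof.
by rewrite /Defs.latvec -sumrN; apply: eq_bigr => i _; rewrite mxE mulrNz.
Qed.

Lemma lipC x y : lip x y = lip y x.
Proof. by rewrite /Defs.lip hermC/= expr0 mul1r. Qed.

Lemma lipDl x y z : lip (x + y) z = lip x z + lip y z.
Proof. by rewrite /Defs.lip latvecD linearDl. Qed.

Lemma lipDr x y z : lip z (x + y) = lip z x + lip z y.
Proof. by rewrite lipC lipDl !(lipC z). Qed.

Lemma lipNl x z : lip (- x) z = - lip x z.
Proof. by rewrite /Defs.lip latvecN linearNl. Qed.

Lemma lipNr x z : lip z (- x) = - lip z x.
Proof. by rewrite lipC lipNl lipC. Qed.

Lemma lip0r x : lip x 0 = 0.
Proof. by rewrite -(subrr 0) lipDr lipNr subrr. Qed.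

Lemma lip_ge0 x : 0 <= lip x x.
Proof.
rewrite /Defs.lip; have [->|/(@neq0_dnorm_gt0 _ _ _ ip _)/ltW//] := eqVneq (latvec x) 0.
by rewrite linear0l.
Qed.

Context (b_basis : basis_of fullv b).

Lemma lip_eq0 x : lip x x = 0 -> x = 0.
Proof.
move=> xx0; have: latvec x = 0.
  by apply/eqP/negP => /negP/(@neq0_dnorm_gt0 _ _ _ ip _); rewrite -/(lip x x) xx0 ltxx.
have bfree : free b by exact: basis_free b_basis.
move=> lx0; apply/rowP => i; rewrite mxE.
have /freeP/(_ (fun i => (x 0 i)%:~R)) H := bfree.
suff /eqP: (x 0 i)%:~R = 0 :> R by rewrite intr_eq0 => /eqP.
apply: H; rewrite -[RHS]lx0; apply: eq_bigr => j _.
by rewrite scaler_int (tnth_nth 0).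
Qed.

Context (L_even : even_lattice ip b).

(** This is [(x + y|x + y) >= 0]; the next lemma is its equality case. *)
Lemma root_lip_ge x y : lip x x = 2 -> lip y y = 2 -> -2 <= lip x y.
Proof.
by move=> xx yy; have := lip_ge0 (x + y); rewrite lipDl !lipDr xx yy (lipC y x); lra.
Qed.

Lemma root_lip_eqN2 x y :
  lip x x = 2 -> lip y y = 2 -> lip x y = -2 -> y = - x.
Proof.
move=> xx yy xy; apply/eqP; rewrite eq_sym -subr_eq0 -opprD oppr_eq0; apply/eqP.
by apply: lip_eq0; rewrite lipDl !lipDr xx yy (lipC y x) xy; lra.
Qed.

(** If [x - y = 3 z] then [9 (z|z) = (x - y|x - y) <= 8], since
    [(x + y|x + y) >= 0].  As [(z|z)] is a nonnegative integer, it is zero.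
    Hence a lattice has at most [3 ^ n] roots. *)
Lemma root_mod3_inj x y : lip x x = 2 -> lip y y = 2 ->
  (forall i, modz (x 0 i) 3%N = modz (y 0 i) 3%N) -> x = y.
Proof.
move=> xx yy xy; pose z : 'rV[int]_n := \row_i divz (x 0 i - y 0 i) 3%N.
have xyz : x - y = z + z + z.
  by apply/rowP => i; rewrite !mxE; have := xy i; move: (x 0 i) (y 0 i) => u v; lia.
have zz9 : lip (x - y) (x - y) = 9 * lip z z.
  by rewrite xyz !(lipDl, lipDr); lra.
suff z0 : z = 0.
  by apply/eqP; rewrite -subr_eq0 xyz z0 !addr0.
apply: lip_eq0.
have [k zz] := L_even z.
have := lip_ge0 (x + y).
move: zz9 (lip_ge0 z); rewrite !(lipDl, lipDr, lipNl, lipNr) xx yy (lipC y x) zz.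
move=> zz9; rewrite ler0z => k0 xy0.
have : (9 * (2 * k))%:~R <= 8%:~R :> R.
  by rewrite [(9 * _)%:~R]rmorphM /= -zz9; lra.
by rewrite ler_int => ?; have -> : k = 0 by lia.
Qed.

End LatticeForm.

(** * Formal distributions *)

Lemma fsbig_seqE (V : nmodType) (I : choiceType) (A : set I) (r : seq I)
    (F : I -> V) :
  uniq r -> (forall i, i \in r -> A i) ->
  (forall i, A i -> i \notin r -> F i = 0) ->
  \sum_(i \in A) F i = \sum_(i <- r) F i.
Proof.
move=> ur rA F0; rewrite (fsbigE r) //.
rewrite big_seq_cond [RHS]big_seq; apply: eq_bigl => i.
by case: (boolP (i \in r)) => // /rA /mem_set ->.
Qed.

Section FormalDistributionTheory.
Context {K : fieldType} {V : lmodType K}.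
Implicit Types (F G : fdist V).

Lemma fd_mul1l F : fd_mul fd_one F = F.
Proof.
apply/funext => m; apply/funext => w; rewrite /fd_mul (@fsbig_seqE _ _ _ [:: m]) //.
  by rewrite big_seq1 subrr /fd_one eqxx.
by move=> i _; rewrite inE /fd_one subr_eq0 eq_sym => /negPf->.
Qed.

Lemma fd_mul1r F : (forall m, F m 0 = 0) -> fd_mul F fd_one = F.
Proof.
move=> F0; apply/funext => m; apply/funext => w.
rewrite /fd_mul (@fsbig_seqE _ _ _ [:: 0]) //.
  by rewrite big_seq1 subr0 /fd_one eqxx.
by move=> i _; rewrite inE /fd_one => /negPf->.
Qed.

Lemma fd_mul0l F : fd_mul (fun _ _ => 0) F = fun _ _ => 0.
Proof. by apply/funext => m; apply/funext => w; rewrite /fd_mul fsbig1. Qed.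

Lemma fd_exp0 : fd_exp (fun _ _ => 0) = fd_one :> fdist V.
Proof.
apply/funext => m; apply/funext => w; rewrite /fd_exp (@fsbig_seqE _ _ _ [:: 0%N]) //.
  by rewrite big_seq1 /= fact0 invr1 scale1r.
by move=> [|i] //= _ _; rewrite fd_mul0l scaler0.
Qed.

Lemma fd_nop1r F : (forall m, F m 0 = 0) -> fd_nop F fd_one = F.
Proof.
move=> F0; apply/funext => m; apply/funext => w; rewrite /fd_nop.
case: (leP 0 m) => m0.
  rewrite (@fsbig_seqE _ _ _ [:: m]) //=; last 2 first.
  - by move=> i; rewrite inE => /eqP->.
  - by move=> i _; rewrite inE /fd_one subr_eq0 eq_sym => /negPf->.
  rewrite fsbig1 => [|j /= j0].
    by rewrite big_seq1 /fd_one subrr eqxx addr0.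
  by rewrite /fd_one subr_eq0 gt_eqF // (lt_le_trans j0 m0).
rewrite fsbig1 => [|j /= j0].
  rewrite (@fsbig_seqE _ _ _ [:: m]) //=; last 2 first.
  - by move=> i; rewrite inE => /eqP->.
  - by move=> i _; rewrite inE /fd_one subr_eq0 eq_sym => /negPf->.
  by rewrite big_seq1 /fd_one subrr eqxx add0r.
by rewrite /fd_one subr_eq0 lt_eqF // (lt_le_trans m0 j0).
Qed.

(* A series without constant term nor negative powers: the k-th power of
   [F] starts in degree [k], so that each coefficient of the exponential is a
   finite sum. *)
Section PositivePart.
Context (F : fdist V) (F0 : forall m, F m 0 = 0).

Lemma iter_fd_mul0r k m : iter k (fd_mul F) fd_one m 0 = 0.
Proof.
elim: k m => [|k IHk] m /=; first by rewrite /fd_one if_same.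
by rewrite /fd_mul fsbig1 // => j _; rewrite IHk F0.
Qed.

Lemma fd_exp0r m : fd_exp F m 0 = 0.
Proof. by rewrite /fd_exp fsbig1 // => k _; rewrite iter_fd_mul0r scaler0. Qed.

Context (F_pos : forall m w, m <= 0 -> F m w = 0).

Lemma iter_fd_mul_lt (k : nat) m w : m < k%:Z -> iter k (fd_mul F) fd_one m w = 0.
Proof.
elim: k m w => [|k IHk] m w mk /=; first by rewrite /fd_one lt_eqF.
rewrite /fd_mul fsbig1 // => j _; have [jk|kj] := ltP j k%:Z.
  by rewrite IHk // F0.
by rewrite F_pos //; lia.
Qed.

Lemma fd_exp_lt0 m w : m < 0 -> fd_exp F m w = 0.
Proof.
move=> m0; rewrite /fd_exp fsbig1 // => k _.
by rewrite iter_fd_mul_lt ?scaler0 //; lia.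
Qed.

Lemma fd_exp_at0 w : fd_exp F 0 w = w.
Proof.
rewrite /fd_exp (@fsbig_seqE _ _ _ [:: 0%N]) //.
  by rewrite big_seq1 /= fact0 invr1 scale1r.
by move=> [|k] // _ _; rewrite iter_fd_mul_lt ?scaler0.
Qed.

Lemma fd_exp_at1 w : fd_exp F 1 w = F 1 w.
Proof.
rewrite /fd_exp (@fsbig_seqE _ _ _ [:: 1%N]) //.
  by rewrite big_seq1 /= fd_mul1r // invr1 scale1r.
move=> [|[|k]] _ kN1 //; last by rewrite iter_fd_mul_lt ?scaler0.
by rewrite /= /fd_one /= scaler0.
Qed.

End PositivePart.
End FormalDistributionTheory.

(** * Vectors supported on a set of basis elements *)

(** The operators below are bare functions satisfying [linear]; the next three
    facts are stated for such functions. *)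
Lemma linear_combination (K : pzRingType) (V W : lmodType K) (g : V -> W) (I : Type)
    (s : seq I) (c : I -> K) (w : I -> V) :
  linear g -> g (\sum_(k <- s) c k *: w k) = \sum_(k <- s) c k *: g (w k).
Proof.
move=> lg; elim: s => [|k s IHs]; last by rewrite !big_cons lg IHs.
by rewrite !big_nil; have := lg (-1) 0 0; rewrite scaler0 addr0 scaleN1r addNr.
Qed.

Lemma linear_scale (K : pzRingType) (V W : lmodType K) (g : V -> W) (c : K) (v : V) :
  linear g -> g (c *: v) = c *: g v.
Proof.
move=> lg; have := linear_combination K V W g unit [:: tt] (fun=> c) (fun=> v) lg.
by rewrite !big_seq1.
Qed.

Lemma linear_addsub (K : pzRingType) (V W : lmodType K) (f g h : V -> W) :
  linear f -> linear g -> linear h -> linear (fun v => f v - g v + h v).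
Proof.
move=> lf lg lh c u v /=; rewrite lf lg lh opprD.
by rewrite [X in X + _ = _]addrACA [LHS]addrACA scalerDr scalerBr.
Qed.

Section SupportedVectors.
Context {R : realType} {n : nat}.
Local Notation C := R[i].
Local Notation VL := (@lattice_voa R n).
Local Notation key := (@fock_basis n).
Implicit Types (f : key -> VL) (Q : set key) (u v : VL).

(** The subalgebras under study and their filtrations are of this form. *)
Definition supported Q : set VL := [set v | forall k, k \in msupp v -> Q k].

Lemma supported0 Q : supported Q 0.
Proof. by move=> k; rewrite msupp0. Qed.

Lemma supportedP Q (c : C) u v :
  supported Q u -> supported Q v -> supported Q (c *: u + v).
Proof.
move=> Qu Qv k /(fsubsetP (msuppD_le _ _)); rewrite in_fsetU => /orP[|/Qv //].
by move=> /(fsubsetP (msuppZ_le _ _)) /Qu.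
Qed.

Lemma supported_subspace Q : is_subspace (supported Q).
Proof. by split; [exact: supported0 | exact: supportedP]. Qed.

Lemma supportedZ Q (c : C) v : supported Q v -> supported Q (c *: v).
Proof. by rewrite -[c *: v]addr0 => Qv; apply: supportedP => //; exact: supported0. Qed.

Lemma supported_sum Q (I : eqType) (r : seq I) (F : I -> VL) :
  (forall i, i \in r -> supported Q (F i)) -> supported Q (\sum_(i <- r) F i).
Proof.
move=> QF; rewrite big_seq; elim/big_ind: _ => //; first exact: supported0.
by move=> u v Qu Qv; rewrite -[u]scale1r; exact: supportedP.
Qed.

Lemma msupp_basis (k : key) : msupp (<< k >> : VL) = [fset k]%fset.
Proof. by rewrite msuppU oner_eq0. Qed.

Lemma supported_basis Q (k : key) : Q k -> supported Q << k >>.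
Proof. by move=> Qk l; rewrite msupp_basis in_fset1 => /eqP ->. Qed.

Lemma supported_sub Q Q' : Q `<=` Q' -> supported Q `<=` supported Q'.
Proof. by move=> sub v Qv k /Qv /sub. Qed.

Lemma basis_expansion v : v = \sum_(k <- msupp v) v@_k *: << k >>.
Proof.
rewrite {1}[v]monalgE; apply: eq_bigr => k _; apply/malgP => l.
by rewrite [RHS]mcoeffZ [LHS]mcoeffU [in RHS]mcoeffU mulr_natr.
Qed.

Lemma lin_extendEw f v (d : {fset key}) : (msupp v `<=` d)%fset ->
  lin_extend f v = \sum_(k <- d) v@_k *: f k.
Proof.
move=> sd; rewrite /lin_extend; apply: big_fset_incl => // k _ /mcoeff_outdom ->.
by rewrite scale0r.
Qed.

Lemma lin_extendP f : linear (lin_extend f).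
Proof.
move=> c u v; pose d := (msupp u `|` msupp v)%fset.
rewrite !(@lin_extendEw _ _ d) ?fsubsetUl ?fsubsetUr //; last first.
  apply: fsubset_trans (msuppD_le _ _) _.
  by apply: fsetSU; exact: msuppZ_le.
rewrite scaler_sumr -big_split; apply: eq_bigr => k _.
by rewrite mcoeffD mcoeffZ scalerDl scalerA.
Qed.

Lemma lin_extend0 f : lin_extend f 0 = 0.
Proof. by rewrite /lin_extend msupp0 big_seq_fset0. Qed.

Lemma lin_extendU f k : lin_extend f << k >> = f k.
Proof. by rewrite /lin_extend msupp_basis big_seq_fset1 mcoeffUU scale1r. Qed.

Lemma lin_extend_supported Q Q' f v :
  (forall k, Q k -> supported Q' (f k)) -> supported Q v ->
  supported Q' (lin_extend f v).
Proof.
by move=> Qf Qv; apply: supported_sum => k /Qv /Qf; exact: supportedZ.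
Qed.

Lemma eq_lin_extend Q f g v :
  (forall k, Q k -> f k = g k) -> supported Q v -> lin_extend f v = lin_extend g v.
Proof. by move=> fg Qv; apply: eq_big_seq => k /Qv /fg ->. Qed.

Lemma lin_extend_id v : lin_extend (fun k => << k >>) v = v.
Proof. by rewrite [RHS]basis_expansion. Qed.

Lemma lin_extend_eq0 Q f v :
  (forall k, Q k -> f k = 0) -> supported Q v -> lin_extend f v = 0.
Proof.
by move=> f0 Qv; rewrite /lin_extend big_seq big1 // => k /Qv /f0 ->; rewrite scaler0.
Qed.

Lemma linear_lin_extend (g : VL -> VL) : linear g ->
  forall v, g v = lin_extend (fun k => g << k >>) v.
Proof. by move=> lg v; rewrite {1}[v]basis_expansion linear_combination. Qed.

End SupportedVectors.

(** * Heisenberg operators *)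

Section ComplexifiedForm.
Context {R : realType} {E : vectType R} (ip : {dot E for @idfun R}).
Context {n : nat} (b : n.-tuple E).
Local Notation C := R[i].
Local Notation cip := (cip ip b).
Local Notation lip := (lip ip b).

Lemma cip_cvec x y : cip (cvec x) (cvec y) = (lip x y)%:C.
Proof.
rewrite /Defs.cip /Defs.lip /latvec linear_sumlz rmorph_sum /=.
apply: eq_bigr => i _; rewrite linear_sumr rmorph_sum /=; apply: eq_bigr => j _.
have -> : ip (tnth b i *~ x 0 i) (tnth b j *~ y 0 j) =
    (x 0 i)%:~R * (y 0 j)%:~R * ip (tnth b i) (tnth b j).
  by rewrite -[_ *~ x 0 i]scaler_int -[_ *~ y 0 j]scaler_int linearZl_LR linearZr_LR /= mulrA.
by rewrite !mxE !rmorphM /= !rmorph_int.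
Qed.

Lemma cip_sym h k : cip h k = cip k h.
Proof.
rewrite /Defs.cip exchange_big; apply: eq_bigr => i _; apply: eq_bigr => j _.
by rewrite mulrC [X in _ = X * _]mulrC mulrC (hermC ip) /= expr0 mul1r.
Qed.

Lemma cip_linearr h : scalar (cip h).
Proof.
move=> c u v; rewrite /Defs.cip mulr_sumr -big_split; apply: eq_bigr => i _ /=.
rewrite mulr_sumr -big_split; apply: eq_bigr => j _ /=; rewrite !mxE; ring.
Qed.

Lemma cip0l k : cip 0 k = 0.
Proof. by rewrite /Defs.cip big1 // => i _; rewrite big1 // => j _; rewrite mxE !mul0r. Qed.

Lemma cvec0 : cvec 0 = 0 :> 'rV[C]_n.
Proof. by apply/rowP => i; rewrite !mxE. Qed.

End ComplexifiedForm.

Section HeisenbergOperators.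
Context {R : realType} {E : vectType R} (ip : {dot E for @idfun R}).
Context {n : nat} (b : n.-tuple E).
Local Notation C := R[i].
Local Notation VL := (@lattice_voa R n).
Local Notation key := (@fock_basis n).
Local Notation heis := (heis ip b).

Lemma heisP h m : linear (heis h m).
Proof. by case: m => [[|p]|p]; exact: lin_extendP. Qed.

Lemma heis0r h m : heis h m 0 = 0.
Proof. by case: m => [[|p]|p]; exact: lin_extend0. Qed.

Lemma heis0l m v : heis 0 m v = 0.
Proof.
case: m => [[|p]|p]; apply: (@lin_extend_eq0 _ _ setT) => // k _.
- by rewrite cip0l scale0r.
- by rewrite big1 // => i _; rewrite cip0l mulr0 mul0r scale0r.
- by rewrite big1 // => i _; rewrite mxE scale0r.
Qed.

Lemma heis_at0 h k : heis h 0 << k >> = cip ip b h (cvec k.2) *: << k >>.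
Proof. exact: lin_extendU. Qed.

Lemma heis_at1 h k : heis h 1 << k >> = \sum_(i < n)
  (1 * cip ip b h (delta_mx 0 i) * (k.1 (0%N, i))%:R) *:
    << (k.1 `\ (0%N, i), k.2)%mset >>.
Proof. exact: lin_extendU. Qed.

Lemma heis_atN1 h k :
  heis h (- 1) << k >> = \sum_(i < n) h 0 i *: << ((0%N, i) +` k.1, k.2)%mset >>.
Proof. exact: lin_extendU. Qed.

(** The fields [h(n)], [n > 0], lower the Fock degree.  Only Fock degrees
    zero and one, as found in weight one, matter for the bracket: [h(1)] maps
    the second below to the first, and [h(n)] kills both for [n > 1]. *)
Definition vacuum_keys : set key := [set k | k.1 = mset0].
Definition low_keys : set key :=
  [set k | k.1 = mset0 \/ exists i, k.1 = [mset (0%N, i)]%mset].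

Lemma heis_vacuum h p v : supported vacuum_keys v -> heis h p.+1%:Z v = 0.
Proof.
apply: lin_extend_eq0 => k k0; apply: big1 => i _.
by rewrite k0 mset0E mulr0 scale0r.
Qed.

Lemma heis_low_gt1 h p v : supported low_keys v -> heis h p.+2%:Z v = 0.
Proof.
apply: lin_extend_eq0 => k [k0|[j kj]]; apply: big1 => i _.
  by rewrite k0 mset0E mulr0 scale0r.
by rewrite kj msetnE mulr0 scale0r.
Qed.

Lemma heis1_low h v : supported low_keys v -> supported vacuum_keys (heis h 1 v).
Proof.
apply: lin_extend_supported => k [k0|[j kj]]; apply: supported_sum => i _.
  by rewrite k0 mset0E mulr0 scale0r; exact: supported0.
rewrite kj msetnE; case: eqP => [->|_].
  apply: supportedZ; apply: supported_basis => /=.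
  by rewrite /vacuum_keys /= msetBxx.
by rewrite mulr0 scale0r; exact: supported0.
Qed.

End HeisenbergOperators.

(** * Weight-one basis vectors and exponentials *)

Section WeightOne.
Context {R : realType} {E : vectType R} (ip : {dot E for @idfun R}).
Context {n : nat} (b : n.-tuple E).
Local Notation key := (@fock_basis n).
Local Notation lip := (lip ip b).
Local Notation weight := (fock_weight ip b).

Definition root_key (x : 'rV[int]_n) : key := (mset0, x).
Definition cartan_key (i : 'I_n) : key := ([mset (0%N, i)]%mset, 0).

Lemma weight_root_key x : weight (root_key x) = lip x x / 2.
Proof. by rewrite /fock_weight /= enum_mset0 big_nil add0r. Qed.

Lemma weight_cartan_key i : weight (cartan_key i) = 1.
Proof. by rewrite /fock_weight /= enum_msetn big_seq1 lip0r mul0r addr0. Qed.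

Context (b_basis : basis_of fullv b) (L_even : even_lattice ip b).

(** The weight is the sum of a positive integer for each element of the
    multiset and of the nonnegative integer [(x|x) / 2]: for the total to be one,
    exactly one of these numbers is present. *)
Lemma weight_one_key k : weight k = 1 ->
  (k.1 = mset0 /\ lip k.2 k.2 = 2) \/ exists i, k = cartan_key i.
Proof.
case: k => A x; rewrite /fock_weight /=.
have [m xx] := L_even x; have m0 := lip_ge0 ip b x.
case: (mset_0Vmem A) => [->|[[p i] Api]].
  by rewrite enum_mset0 big_nil => w1; left; split => //; lra.
move=> w1; right; exists i.
have /perm_to_rem pA : (p, i) \in enum_mset A by [].
move: w1; rewrite (perm_big _ pA) big_cons /=.
set s := rem _ _ in pA *; have s0 : 0 <= \sum_(y <- s) (y.1.+1)%:R :> R.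
  by apply: sumr_ge0.
rewrite -natr1; have p0 : 0 <= p%:R :> R by []. move=> w1.
have pE : p%:R = 0 :> R by lra.
have xE : lip x x = 0 by lra.
move: s0 w1 pA; case: s => [|[q j] s]; last first.
  rewrite big_cons /= -natr1; have := ler0n R q.
  have : 0 <= \sum_(y <- s) (y.1.+1)%:R :> R by apply: sumr_ge0.
  by move=> *; exfalso; lra.
move=> _ _ pA; move/eqP: pE; rewrite pnatr_eq0 => /eqP pE; subst p.
rewrite /cartan_key (lip_eq0 ip b b_basis x xE); congr pair.
by rewrite -[LHS]seq_mset_id -[RHS]seq_mset_id; apply/eq_seq_msetP; rewrite enum_msetn.
Qed.

End WeightOne.

Section ExponentialOperators.
Context {R : realType} {E : vectType R} (ip : {dot E for @idfun R}).
Context {n : nat} (b : n.-tuple E) (eps : 'rV[int]_n -> 'rV[int]_n -> int).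
Local Notation C := R[i].
Local Notation VL := (@lattice_voa R n).
Local Notation key := (@fock_basis n).
Local Notation heis := (heis ip b).
Local Notation lip := (lip ip b).
Local Notation low_keys := (@low_keys n).
Local Notation vacuum_keys := (@vacuum_keys n).
Local Notation create := (creation_exponent ip b).
Local Notation annihilate := (annihilation_exponent ip b).

Lemma create0r h m : create h m 0 = 0.
Proof. by rewrite /create heis0r scaler0 if_same. Qed.

Lemma create_le0 h m w : m <= 0 -> create h m w = 0.
Proof. by rewrite /create ltNge => ->. Qed.

Lemma fd_exp_create0 h w : fd_exp (create h) 0 w = w.
Proof. exact: fd_exp_at0 (create0r h) (@create_le0 h) w. Qed.

Lemma fd_exp_create1 h w : fd_exp (create h) 1 w = heis h (- 1) w.
Proof.
rewrite (fd_exp_at1 _ (create0r h) (@create_le0 h)).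
by rewrite /create ltr01 invr1 scale1r.
Qed.

Lemma annihilate_ge0 h m w : 0 <= m -> annihilate h m w = 0.
Proof. by rewrite /annihilate ltNge => ->. Qed.

Lemma annihilateN1 h w : annihilate h (- 1) w = - heis h 1 w.
Proof. by rewrite /annihilate ltrN10 opprK invr1 scale1r. Qed.

Lemma annihilate0r h m : annihilate h m 0 = 0.
Proof. by rewrite /annihilate heis0r scaler0 oppr0 ?if_same. Qed.

Lemma annihilate_vacuum h m w : supported vacuum_keys w -> annihilate h m w = 0.
Proof.
case: m => [m|m] w0; first by rewrite annihilate_ge0.
by rewrite /annihilate NegzE opprK heis_vacuum // scaler0 oppr0 ?if_same.
Qed.

Lemma annihilate_low_lt h m w :
  supported low_keys w -> m != -1 -> annihilate h m w = 0.
Proof.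
case: m => [m|[|m]] w0 // _.
by rewrite /annihilate NegzE opprK heis_low_gt1 // scaler0 oppr0 ?if_same.
Qed.

Lemma annihilate_low h m w :
  supported low_keys w -> supported vacuum_keys (annihilate h m w).
Proof.
move=> w0; have [->|m1] := eqVneq m (-1); last first.
  by rewrite annihilate_low_lt //; exact: supported0.
rewrite annihilateN1 -scaleN1r; apply: supportedZ; exact: heis1_low.
Qed.

(** A first annihilation leads to Fock degree zero, where a second one gives
    zero.  So the exponential reduces to its linear part. *)
Lemma iter_annihilate_low h k m w : supported low_keys w ->
  supported vacuum_keys (iter k.+1 (fd_mul (annihilate h)) fd_one m w).
Proof.
move=> w0; elim: k m => [|k IHk] m.
  by rewrite /= fd_mul1r; [exact: annihilate_low | exact: annihilate0r].
rewrite iterS /fd_mul fsbig1 => [|j _]; first exact: supported0.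
exact: annihilate_vacuum.
Qed.

Lemma fd_exp_annihilate_low h m w : supported low_keys w ->
  fd_exp (annihilate h) m w = fd_one m w + annihilate h m w.
Proof.
move=> w0; rewrite /fd_exp (@fsbig_seqE _ _ _ [:: 0%N; 1%N]) //; last first.
  move=> [|[|k]] // _ _; rewrite iterS /fd_mul fsbig1 ?scaler0 // => j _.
  exact/annihilate_vacuum/iter_annihilate_low.
rewrite big_cons big_seq1 /= !invr1 !scale1r fd_mul1r //.
exact: annihilate0r.
Qed.

End ExponentialOperators.

(** * Vertex operators on weight-one vectors *)

Section VertexOperators.
Context {R : realType} {E : vectType R} (ip : {dot E for @idfun R}).
Context {n : nat} (b : n.-tuple E) (eps : 'rV[int]_n -> 'rV[int]_n -> int).
Local Notation C := R[i].
Local Notation VL := (@lattice_voa R n).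
Local Notation key := (@fock_basis n).
Local Notation heis := (heis ip b).
Local Notation lip := (lip ip b).
Local Notation low_keys := (@low_keys n).
Local Notation vacuum_keys := (@vacuum_keys n).
Local Notation bracket := (zero_bracket ip b eps).
Local Notation W1 := [set k : key | fock_weight ip b k = 1].

(** The coefficient of [z^m] in [e_x z^x]. *)
Definition twisted_shift (x : 'rV[int]_n) (m : int) (k : key) : VL :=
  if lip x k.2 == m%:~R then (eps x k.2)%:~R *: << (k.1, x + k.2) >> else 0.

Local Notation T x m := (lin_extend (twisted_shift x m)).

Lemma shift_zpowE x m v : shift_op eps x (zpow_op ip b x m v) = T x m v.
Proof.
rewrite (linear_lin_extend (fun v => shift_op eps x (zpow_op ip b x m v))).
  apply: (@eq_lin_extend _ _ setT) => // k _; rewrite /zpow_op lin_extendU /twisted_shift.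
  by case: ifP => _; rewrite /shift_op ?lin_extend0 ?lin_extendU.
by move=> c u w; rewrite /zpow_op lin_extendP /shift_op lin_extendP.
Qed.

Lemma exp_vertexE x : exp_vertex ip b eps x =
  fd_mul (fd_exp (creation_exponent ip b (cvec x)))
    (fd_mul (fd_exp (annihilation_exponent ip b (cvec x))) (fun m w => T x m w)).
Proof.
have TE : (fun m w => shift_op eps x (zpow_op ip b x m w)) = fun m w => T x m w.
  by apply/funext => m; apply/funext => w; exact: shift_zpowE.
by rewrite -TE.
Qed.

Lemma zero_bracket_basis k v : bracket << k >> v = basis_vertex ip b eps k (- 1) v.
Proof.
by rewrite /zero_bracket /vertex_op msupp_basis big_seq_fset1 mcoeffUU scale1r.
Qed.

Context (b_basis : basis_of fullv b) (L_even : even_lattice ip b).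
Context (eps_cocycle : lattice_cocycle ip b eps).

(** For [x = 0] both exponentials are the identity as well as [e_0 z^0], so
    that [Y(h(-1) e^0, z) = h(z)] holds on the whole space. *)
Lemma exp_vertex0 : exp_vertex ip b eps 0 = fd_one.
Proof.
have create0 : creation_exponent ip b 0 = fun _ _ => 0.
  apply/funext => m; apply/funext => w.
  by rewrite /creation_exponent heis0l scaler0 if_same.
have annihilate0 : annihilation_exponent ip b 0 = fun _ _ => 0.
  apply/funext => m; apply/funext => w.
  by rewrite /annihilation_exponent heis0l scaler0 oppr0 if_same.
rewrite /exp_vertex cvec0 create0 annihilate0 fd_exp0 !fd_mul1l.
apply/funext => m; apply/funext => w; rewrite shift_zpowE /fd_one.
have [_ _ _ eps0] := eps_cocycle.
case: eqP => [->|/eqP m0].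
  rewrite -[RHS]lin_extend_id; apply: (@eq_lin_extend _ _ setT) => // -[A y] _.
  by rewrite /twisted_shift lipC lip0r eqxx (eps0 y).1 add0r scale1r.
apply: (@lin_extend_eq0 _ _ setT) => // k _.
by rewrite /twisted_shift lipC lip0r eq_sym intr_eq0 (negPf m0).
Qed.

Lemma bracket_cartan i v : bracket << cartan_key i >> v = heis (delta_mx 0 i) 0 v.
Proof.
rewrite zero_bracket_basis /basis_vertex /= enum_msetn /= exp_vertex0.
rewrite fd_nop1r => [|m]; rewrite /fd_divderiv /= invr1 scale1r /heis_field.
  by rewrite opprK subrr.
by rewrite heis0r.
Qed.

Section Root.
Context (x : 'rV[int]_n) (x_root : lip x x = 2).

Lemma twisted_shift_low m v : supported W1 v -> supported low_keys (T x m v).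
Proof.
apply: lin_extend_supported => k /(weight_one_key ip b b_basis L_even) k1.
rewrite /twisted_shift; case: ifP => _; last exact: supported0.
apply: supportedZ; apply: supported_basis.
by case: k1 => [[k0 _]|[i ->]]; [left | right; exists i].
Qed.

(** A weight-one vector of Fock degree one is in the Cartan part, on which
    [z^x] is constant. *)
Lemma twisted_shift_vacuum m v : m != 0 ->
  supported W1 v -> supported vacuum_keys (T x m v).
Proof.
move=> m0; apply: lin_extend_supported => k /(weight_one_key ip b b_basis L_even) k1.
rewrite /twisted_shift; case: ifP => [|_]; last exact: supported0.
case: k1 => [[k0 _]|[i -> /=]]; first by move=> _; apply: supportedZ; apply: supported_basis.
by rewrite lip0r eq_sym intr_eq0 (negPf m0).
Qed.

Lemma twisted_shift_lt m v : m < - 2%:Z -> supported W1 v -> T x m v = 0.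
Proof.
move=> m2; apply: lin_extend_eq0 => k /(weight_one_key ip b b_basis L_even) k1.
rewrite /twisted_shift; case: ifP => // /eqP xk; exfalso.
have : m%:~R < (- 2%:Z)%:~R :> R by rewrite ltr_int.
rewrite -xk; case: k1 => [[_ kk]|[i -> /=]]; last by rewrite lip0r; lra.
by have := root_lip_ge ip b x k.2 x_root kk; lra.
Qed.

(** In the product of the creation exponential with
    [D(z) = exp(annihilation) e_x z^x], the coefficient of [z^-1] pairs
    degree [j] of [D(z) v] with degree [-1 - j] of the creation exponential.
    The latter requires [j <= -1] and the former [j >= -2]; the two remaining
    degrees give the identity and [x(-1)]. *)
Lemma exp_vertex_weight_one v : supported W1 v ->
  exp_vertex ip b eps x (- 1) v =
    T x (- 1) v - heis (cvec x) 1 (T x 0 v) + heis (cvec x) (- 1) (T x (- 2%:Z) v).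
Proof.
move=> v1; pose A := fd_exp (annihilation_exponent ip b (cvec x)).
pose D := fd_mul A (fun m w => T x m w).
have -> : exp_vertex ip b eps x = fd_mul (fd_exp (creation_exponent ip b (cvec x))) D.
  exact: exp_vertexE.
have AE m w : supported low_keys w ->
    A m w = fd_one m w + annihilation_exponent ip b (cvec x) m w.
  exact: fd_exp_annihilate_low.
have Tlow := twisted_shift_low ^~ v ^~ v1.
(* The annihilation exponential contributes its terms in [z^0] and [z^-1]. *)
have DE m : D m v = T x m v - heis (cvec x) 1 (T x (m + 1) v).
  rewrite /D /fd_mul (@fsbig_seqE _ _ _ [:: m; m + 1]) //=; last 2 first.
  - by rewrite inE andbT; lia.
  - move=> j _; rewrite !inE negb_or => /andP[jm jm1].
    rewrite AE // annihilate_low_lt //; last by lia.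
    by rewrite /fd_one subr_eq0 eq_sym (negPf jm) addr0.
  rewrite big_cons big_seq1.
  rewrite (AE _ (T x m v)) // (AE _ (T x (m + 1) v)) //.
  rewrite subrr (_ : m - (m + 1) = -1); last by lia.
  by rewrite /fd_one eqxx annihilateN1 annihilate_ge0 // addr0 add0r.
have DN1 m : m != -1 -> D m v = T x m v.
  move=> m1; rewrite DE (heis_vacuum _ _ _ 0) ?subr0 //.
  by apply: twisted_shift_vacuum => //; lia.
rewrite /fd_mul (@fsbig_seqE _ _ _ [:: - 1; - 2%:Z]) //; last first.
  move=> j _; rewrite !inE negb_or => /andP[j1 j2].
  have [j0|j0] := ltP j (-1); last first.
    by apply: fd_exp_lt0; [exact: create0r | exact: create_le0 | lia].
  rewrite DN1 // twisted_shift_lt //; last by lia.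
  by apply: fd_exp0r; exact: create0r.
rewrite big_cons big_seq1 subrr (_ : - 1 - - 2%:Z = 1) //.
by rewrite fd_exp_create0 fd_exp_create1 DE DN1.
Qed.

Lemma bracket_root v : supported W1 v -> bracket << root_key x >> v =
    T x (- 1) v - heis (cvec x) 1 (T x 0 v) + heis (cvec x) (- 1) (T x (- 2%:Z) v).
Proof.
by move=> v1; rewrite zero_bracket_basis /basis_vertex /= enum_mset0 /= exp_vertex_weight_one.
Qed.

End Root.
End VertexOperators.

(** * The table of brackets *)

Section BracketTable.
Context {R : realType} {E : vectType R} (ip : {dot E for @idfun R}).
Context {n : nat} (b : n.-tuple E) (eps : 'rV[int]_n -> 'rV[int]_n -> int).
Local Notation C := R[i].
Local Notation VL := (@lattice_voa R n).
Local Notation key := (@fock_basis n).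
Local Notation heis := (heis ip b).
Local Notation lip := (lip ip b).
Local Notation cip := (cip ip b).
Local Notation bracket := (zero_bracket ip b eps).
Local Notation W1 := [set k : key | fock_weight ip b k = 1].
Local Notation T x m := (lin_extend (twisted_shift ip b eps x m)).

Context (b_basis : basis_of fullv b) (L_even : even_lattice ip b).
Context (eps_cocycle : lattice_cocycle ip b eps).

(** The vector [h(-1) e^0]. *)
Definition cartan_vec (h : 'rV[C]_n) : VL := \sum_(i < n) h 0 i *: << cartan_key i >>.

Lemma bracket_cartan_basis i k :
  bracket << cartan_key i >> << k >> = cip (delta_mx 0 i) (cvec k.2) *: << k >>.
Proof. by rewrite bracket_cartan // heis_at0. Qed.

Lemma bracket_linearl v : linear (fun u => bracket u v).
Proof. exact: lin_extendP. Qed.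

Lemma cip_suml h k : cip h k = \sum_(i < n) h 0 i * cip (delta_mx 0 i) k.
Proof.
rewrite cip_sym [in LHS](row_sum_delta h).
rewrite (@linear_combination _ _ (C^o) (cip k)); last exact: cip_linearr.
by apply: eq_bigr => i _; rewrite cip_sym.
Qed.

Lemma bracket_cartan_vec h k :
  bracket (cartan_vec h) << k >> = cip h (cvec k.2) *: << k >>.
Proof.
rewrite (linear_combination _ _ _ (fun u => bracket u << k >>)); last exact: bracket_linearl.
rewrite cip_suml scaler_suml; apply: eq_bigr => i _.
by rewrite bracket_cartan_basis scalerA.
Qed.

Lemma twisted_shift_if x m k :
  T x m << k >> = if lip x k.2 == m%:~R then (eps x k.2)%:~R *: << (k.1, x + k.2) >> else 0.
Proof. exact: lin_extendU. Qed.

Section Root.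
Context (x : 'rV[int]_n) (x_root : lip x x = 2).

Lemma bracket_root_cartan i : bracket << root_key x >> << cartan_key i >> =
  - cip (cvec x) (delta_mx 0 i) *: << root_key x >>.
Proof.
rewrite bracket_root //; last by apply: supported_basis; exact: weight_cartan_key.
have [_ _ _ eps0] := eps_cocycle.
rewrite !twisted_shift_if /= lip0r eqxx (eps0 x).2 addr0 scale1r.
rewrite -[0]/((0 : int)%:~R) !eqr_int /= heis0r addr0 sub0r scaleNr; congr (- _).
rewrite heis_at1 /= (bigD1 i) //= big1 => [|j ji].
  by rewrite addr0 msetnE eqxx mulr1 mul1r msetBxx.
by rewrite msetnE xpair_eqE (negPf ji) andbF mulr0 scale0r.
Qed.

Context (y : 'rV[int]_n) (y_root : lip y y = 2).

Let root_key_W1 : supported W1 (<< root_key y >> : VL).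
Proof. by apply: supported_basis; rewrite /= weight_root_key y_root divff ?pnatr_eq0. Qed.

Let heis1_eq0 h m : heis h 1 (T x m << root_key y >>) = 0.
Proof.
apply: (heis_vacuum _ _ _ 0); rewrite twisted_shift_if.
case: ifP => _; last exact: supported0.
by apply: supportedZ; apply: supported_basis.
Qed.

Lemma bracket_rootsN1 : lip x y = - 1 ->
  bracket << root_key x >> << root_key y >> = (eps x y)%:~R *: << root_key (x + y) >>.
Proof.
move=> xy; rewrite bracket_root // heis1_eq0 !twisted_shift_if /= xy.
by rewrite -[-1]/((-1 : int)%:~R) !eqr_int /= heis0r subr0 addr0.
Qed.

Lemma bracket_rootsN2 : y = - x ->
  bracket << root_key x >> << root_key y >> = (eps x y)%:~R *: cartan_vec (cvec x).
Proof.
move=> yx; have xy : lip x y = (- 2%:Z)%:~R by rewrite yx lipNr x_root.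
rewrite bracket_root // heis1_eq0 !twisted_shift_if /= xy !eqr_int /= subr0 add0r.
have -> : x + y = 0 by rewrite yx subrr.
rewrite (@linear_scale _ _ _ (heis (cvec x) (- 1))); last exact: heisP.
apply: (f_equal (GRing.scale _)).
by rewrite heis_atN1; apply: eq_bigr => i _; rewrite msetD0.
Qed.

Lemma bracket_roots_eq0 : lip x y != - 1 -> y <> - x ->
  bracket << root_key x >> << root_key y >> = 0.
Proof.
move=> xy1 xy2; rewrite bracket_root // heis1_eq0 !twisted_shift_if /=.
rewrite ifN // ifN ?heis0r ?subr0 ?addr0 //.
by apply: contra_not_neq xy2 => /(root_lip_eqN2 ip b b_basis x y x_root y_root).
Qed.

End Root.

(** On weight-one vectors the bracket is determined by the basis: it is linear
    on the left by definition, and on the right each basis vector acts by one of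
    the linear expressions found above. *)
Lemma bracket_lin_extend u v : supported W1 u -> supported W1 v ->
  bracket u v = lin_extend (fun k => lin_extend (fun l => bracket << k >> << l >>) v) u.
Proof.
move=> u1 v1.
transitivity (lin_extend (fun k => bracket << k >> v) u).
  exact: (linear_lin_extend (fun u => bracket u v) (bracket_linearl v)).
refine (eq_lin_extend W1 _ _ u _ u1) => -[A x] k1.
have [[/= A0 x2]|[i ->]] := weight_one_key _ _ b_basis L_even _ k1; last first.
  transitivity (lin_extend (fun l => heis (delta_mx 0 i) 0 << l >>) v).
    rewrite (bracket_cartan _ _ _ eps_cocycle).
    exact: (linear_lin_extend (heis (delta_mx 0 i) 0) (heisP ip b _ _)).
  refine (eq_lin_extend W1 _ _ v _ v1) => l _; by rewrite (bracket_cartan _ _ _ eps_cocycle).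
subst A; rewrite (bracket_root _ _ _ b_basis L_even _ x2 _ v1).
pose g v : VL := T x (- 1) v - heis (cvec x) 1 (T x 0 v) + heis (cvec x) (- 1) (T x (- 2%:Z) v).
transitivity (lin_extend (fun l => g << l >>) v); last first.
  refine (eq_lin_extend W1 _ _ v _ v1) => l l1.
  by rewrite (bracket_root _ _ _ b_basis L_even _ x2 _ (supported_basis _ _ l1)).
apply: (linear_lin_extend g).
have heisT h i j : linear (fun v => heis h i (T x j v)).
  by move=> c w w'; rewrite lin_extendP heisP.
exact: (linear_addsub _ _ _ _ _ _ (lin_extendP _) (heisT _ _ _) (heisT _ _ _)).
Qed.

Lemma bracket_supported Q1 Q2 Q3 : Q1 `<=` W1 -> Q2 `<=` W1 ->
  (forall k l, Q1 k -> Q2 l -> supported Q3 (bracket << k >> << l >>)) ->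
  forall u v, supported Q1 u -> supported Q2 v -> supported Q3 (bracket u v).
Proof.
move=> Q1W Q2W Q12 u v u1 v2; rewrite bracket_lin_extend; last 2 first.
- exact: supported_sub u1.
- exact: supported_sub v2.
apply: (lin_extend_supported Q1) => // k k1.
by apply: (lin_extend_supported Q2) => // l l2; exact: Q12.
Qed.

End BracketTable.

(** * Subalgebras and solvability *)

Section Subspaces.
Context {K : fieldType} {V : lmodType K}.

Lemma subspaceZ (S : set V) (c : K) v : is_subspace S -> S v -> S (c *: v).
Proof. by case=> S0 SP Sv; rewrite -[c *: v]addr0; exact: SP. Qed.

Lemma subspaceZ_iff (S : set V) (c : K) v : is_subspace S -> c != 0 ->
  S (c *: v) -> S v.
Proof. by move=> SS c0 /(subspaceZ _ c^-1 _ SS); rewrite scalerK. Qed.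

Lemma linear_span_subspace (A : set V) : is_subspace (linear_span A).
Proof.
split=> [S [S0 _] _ //|c u v uA vA S SS AS].
by case: (SS) => _; apply; [exact: uA | exact: vA].
Qed.

Lemma derived_algebra_sub (br : V -> V -> V) (s S : set V) : is_subspace S ->
  (forall u v, s u -> s v -> S (br u v)) -> derived_algebra br s `<=` S.
Proof. by move=> SS brS v /(_ S SS); apply=> w [u [u' [su su' ->]]]; exact: brS. Qed.

Lemma derived_algebra_br (br : V -> V -> V) (s : set V) u v :
  s u -> s v -> derived_algebra br s (br u v).
Proof. by move=> su sv S _; apply; exists u, v. Qed.

(** Each of [e], [f], [h] is a multiple of a bracket of two of them, so that
    all three survive in every term of the derived series. *)
Lemma not_solvable_sl2 (br : V -> V -> V) (t : set V) (e f h : V) (c : K) :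
  t e -> t f -> t h -> e != 0 -> c != 0 ->
  br h e = c *: e -> br h f = - c *: f -> (exists2 d, d != 0 & br e f = d *: h) ->
  ~ is_solvable br t.
Proof.
move=> te tf th e0 c0 he hf [d d0 ef] [k kt].
suff [/kt /= e00 _]: [/\ iter k (derived_algebra br) t e,
    iter k (derived_algebra br) t f & iter k (derived_algebra br) t h].
  by rewrite e00 eqxx in e0.
elim: k {kt} => [|k [IHe IHf IHh]] //; rewrite iterS.
set s := iter _ _ _ in IHe IHf IHh *.
have SS : is_subspace (derived_algebra br s) by exact: linear_span_subspace.
split.
- by apply: (subspaceZ_iff _ c _ SS c0); rewrite -he; exact: derived_algebra_br.
- apply: (subspaceZ_iff _ (- c) _ SS); first by rewrite oppr_eq0.
  by rewrite -hf; exact: derived_algebra_br.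
- by apply: (subspaceZ_iff _ d _ SS d0); rewrite -ef; exact: derived_algebra_br.
Qed.

End Subspaces.

Section WeightOneLieAlgebra.
Context {R : realType} {E : vectType R} (ip : {dot E for @idfun R}).
Context {n : nat} (b : n.-tuple E) (eps : 'rV[int]_n -> 'rV[int]_n -> int).
Local Notation C := R[i].
Local Notation VL := (@lattice_voa R n).
Local Notation key := (@fock_basis n).
Local Notation lip := (lip ip b).
Local Notation cip := (cip ip b).
Local Notation bracket := (zero_bracket ip b eps).
Local Notation W1 := [set k : key | fock_weight ip b k = 1].

Context (b_basis : basis_of fullv b) (L_even : even_lattice ip b).
Context (eps_cocycle : lattice_cocycle ip b eps).

Definition keys_over (M : set 'rV[int]_n) : set key :=
  [set k | M k.2 /\ fock_weight ip b k = 1].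

Lemma weight_one_sub_voa M :
  weight_one ip b (sub_voa M) = supported (keys_over M) :> set VL.
Proof.
apply/seteqP; split => v; first by move=> [Mv v1] k kv; split; [exact: Mv|exact: v1].
by move=> Mv; split => k /Mv [].
Qed.

Lemma keys_over_W1 M : keys_over M `<=` W1.
Proof. by move=> k []. Qed.

Lemma root_key_weight x : lip x x = 2 -> fock_weight ip b (root_key x) = 1.
Proof. by rewrite weight_root_key => ->; rewrite divff ?pnatr_eq0. Qed.

(** Beside the grading by the lattice, this contains the fact that [x + y] is a
    root whenever [x] and [y] are roots with [(x|y) = -1]. *)
Lemma bracket_graded k l : W1 k -> W1 l ->
  supported (keys_over [set k.2 + l.2]) (bracket << k >> << l >>).
Proof.
move=> k1 l1.
have [[/= A0 x2]|[i kE]] := weight_one_key _ _ b_basis L_even _ k1; last first.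
  rewrite kE (bracket_cartan_basis _ _ _ eps_cocycle); apply: supportedZ.
  by apply: supported_basis; split => //=; rewrite add0r.
case: k A0 x2 k1 => _ x /= -> x2 k1.
have [[/= A0 y2]|[i lE]] := weight_one_key _ _ b_basis L_even _ l1; last first.
  rewrite lE (bracket_root_cartan _ _ _ b_basis L_even eps_cocycle _ x2).
  apply: supportedZ; apply: supported_basis; split => //=; first by rewrite addr0.
case: l A0 y2 l1 => _ y /= -> y2 l1.
case: (eqVneq (lip x y) (- 1)) => [xy|xy].
  rewrite (bracket_rootsN1 _ _ _ b_basis L_even _ x2 _ y2 xy).
  apply: supportedZ; apply: supported_basis; split => //=.
  by apply: root_key_weight; rewrite !lipDl !lipDr x2 y2 (lipC _ _ y x) xy; lra.
case: (eqVneq y (- x)) => [yx|yx].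
  rewrite (bracket_rootsN2 _ _ _ b_basis L_even _ x2 _ y2 yx).
  apply: supportedZ; apply: supported_sum => i _.
  apply: supportedZ; apply: supported_basis; split => /=; first by rewrite yx subrr.
  exact: weight_cartan_key.
rewrite (bracket_roots_eq0 _ _ _ b_basis L_even _ x2 _ y2 xy (elimN eqP yx)).
exact: supported0.
Qed.

Lemma sub_voa_subalgebra M : is_submonoid M ->
  is_subalgebra bracket (weight_one ip b (sub_voa setT)) (weight_one ip b (sub_voa M)).
Proof.
move=> [M0 MD]; rewrite !weight_one_sub_voa; split.
- by apply: supported_sub => k [].
- exact: supported_subspace.
- apply: (bracket_supported _ _ _ b_basis L_even eps_cocycle);
    try exact: keys_over_W1.
  move=> k l [Mk k1] [Ml l1]; apply: (supported_sub _ _ _ _ (bracket_graded k l k1 l1)).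
  by move=> m [/= mE m1]; split => //; rewrite mE; exact: MD.
Qed.

Section Borel.
Context (B : set 'rV[int]_n) (B_borel : borel_type ip b B).

Let B0 : B 0. Proof. by case: B_borel => -[]. Qed.
Let BD x y : B x -> B y -> B (x + y). Proof. by case: B_borel => -[_ BD] _ _ _; exact: BD. Qed.
Let BN x : B x -> B (- x) -> x = 0.
Proof.
move=> Bx BNx; case: B_borel => _ _ /seteqP[sub _] _; apply: sub; split => //.
by exists (- x) => //; rewrite opprK.
Qed.
Let B_total x : B x \/ B (- x).
Proof.
case: B_borel => _ /seteqP[_ sub] _ _.
by have [|[y By <-]] := sub x I; [left|right; rewrite opprK].
Qed.

(** Residues stand for roots in the finite type needed to count them. *)
Definition residue3 (x : 'rV[int]_n) : {ffun 'I_n -> 'I_3} :=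
  [ffun i => inord (absz (modz (x 0 i) 3%N))].

Lemma residue3_inj x y : lip x x = 2 -> lip y y = 2 -> residue3 x = residue3 y -> x = y.
Proof.
move=> x2 y2 /ffunP xy; apply: (root_mod3_inj _ _ b_basis L_even) => // i.
have := xy i; rewrite !ffunE => /(congr1 val); rewrite /= !inordK; lia.
Qed.

(** The number of roots [y] with [y <= x] for the order with positive cone
    [B]. *)
Definition height (x : 'rV[int]_n) : nat :=
  #|[set t : {ffun 'I_n -> 'I_3} |
     `[< exists y, [/\ lip y y = 2, B (x - y) & residue3 y = t] >]]%SET|.

(** Every root below [x] is below [x + y], and the root [x + y] itself is not
    below [x] because [- y] is not in [B]. *)
Lemma height_lt x y : B y -> y != 0 -> lip (x + y) (x + y) = 2 ->
  (height x < height (x + y))%N.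
Proof.
move=> By y0 xy2; apply: proper_card; apply/fintype.properP; split.
  apply/fintype.subsetP => t; rewrite !inE => -[z [z2 xz <-]].
  by exists z; split=> //; rewrite addrAC; exact: BD.
exists (residue3 (x + y)); rewrite inE.
  by apply/asboolP; exists (x + y); split => //; rewrite subrr; exact: B0.
apply/asboolP => -[z [z2 xz /(residue3_inj _ _ z2 xy2) zE]].
move: xz; rewrite zE // opprD addNKr => BNy.
by move/eqP: y0; apply; exact: BN.
Qed.

(** The filtration of the nilradical by height. *)
Definition nil_keys (j : nat) : set key :=
  [set k | [/\ keys_over B k, k.2 != 0 & (j <= height k.2)%N]].

Lemma nil_keys_W1 j : nil_keys j `<=` W1.
Proof. by move=> k [[]]. Qed.

(** If the degrees [k.2] and [l.2] add up to zero they both vanish, and the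
    bracket is one of two Cartan vectors. *)
Lemma bracket_borel k l : keys_over B k -> keys_over B l ->
  supported (nil_keys 0) (bracket << k >> << l >>).
Proof.
move=> [Bk k1] [Bl l1].
have [kl0|kl0] := eqVneq (k.2 + l.2) 0; last first.
  apply: (supported_sub _ _ _ _ (bracket_graded k l k1 l1)) => m [/= mE m1].
  by split => //; [split => //; rewrite mE; exact: BD | rewrite mE].
have l0 : l.2 = 0.
  by apply: BN => //; rewrite (_ : - l.2 = k.2) //; apply/eqP; rewrite eq_sym -addr_eq0 kl0.
have k0 : k.2 = 0 by rewrite l0 addr0 in kl0.
have [[_]|[i ->]] := weight_one_key _ _ b_basis L_even _ k1.
  by rewrite k0 lip0r => /eqP; rewrite eq_sym pnatr_eq0.
rewrite (bracket_cartan_basis _ _ _ eps_cocycle) l0 cvec0 cip_sym cip0l scale0r.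
exact: supported0.
Qed.

Lemma bracket_nil j k l : nil_keys j k -> nil_keys j l ->
  supported (nil_keys j.+1) (bracket << k >> << l >>).
Proof.
move=> [Bk k0 jk] [Bl l0 jl].
have [[Bk2 k1] [Bl2 l1]] := (Bk, Bl).
move=> m mkl; have [mE m1] := bracket_graded k l k1 l1 m mkl.
have [Bm m0 _] := bracket_borel k l Bk Bl m mkl; split => //.
rewrite mE; apply: leq_ltn_trans jk _; apply: height_lt => //.
rewrite -mE; have [[_ ->]|[i mi]] := weight_one_key _ _ b_basis L_even _ m1 => //.
by rewrite mi eqxx in m0.
Qed.

Lemma borel_solvable : is_solvable bracket (supported (keys_over B)).
Proof.
pose N := #|{ffun 'I_n -> 'I_3}|.
have sub j : iter j.+1 (derived_algebra bracket) (supported (keys_over B))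
    `<=` supported (nil_keys j).
  elim: j => [|j IHj].
    apply: derived_algebra_sub; first exact: supported_subspace.
    apply: (bracket_supported _ _ _ b_basis L_even eps_cocycle) bracket_borel;
      exact: keys_over_W1.
  rewrite iterS; apply: derived_algebra_sub; first exact: supported_subspace.
  move=> u v /IHj u1 /IHj v1.
  apply: (bracket_supported _ _ _ b_basis L_even eps_cocycle _ _ _ _ _ (bracket_nil j)) => //;
   exact: nil_keys_W1.
exists N.+2 => v /sub v0 /=; rewrite -[v]lin_extend_id.
apply: (lin_extend_eq0 _ _ _ _ v0) => k [_ _].
by rewrite leqNgt ltnS max_card.
Qed.

End Borel.
End WeightOneLieAlgebra.

(** * Maximality *)

Section Maximality.
Context {R : realType} {E : vectType R} (ip : {dot E for @idfun R}).
Context {n : nat} (b : n.-tuple E) (eps : 'rV[int]_n -> 'rV[int]_n -> int).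
Local Notation C := R[i].
Local Notation VL := (@lattice_voa R n).
Local Notation key := (@fock_basis n).
Local Notation lip := (lip ip b).
Local Notation cip := (cip ip b).
Local Notation bracket := (zero_bracket ip b eps).
Local Notation W1 := [set k : key | fock_weight ip b k = 1].

Context (b_basis : basis_of fullv b) (L_even : even_lattice ip b).
Context (eps_cocycle : lattice_cocycle ip b eps).

Lemma mcoeff_lin_extend_diag (c : key -> C) (v : VL) k :
  (lin_extend (fun l => c l *: << l >>) v)@_k = c k * v@_k.
Proof.
rewrite /lin_extend raddf_sum /=.
have coefE l : (v@_l *: (c l *: << l >>) : VL)@_k = if l == k then c k * v@_k else 0.
  rewrite [LHS]mcoeffZ [X in _ * X]mcoeffZ [X in _ * (_ * X)]mcoeffU.
  by case: eqP => [->|_]; rewrite ?mulr1 ?mulr0 // mulrC.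
rewrite (eq_bigr _ (fun l _ => coefE l)).
case: (boolP (k \in msupp v)) => [kv|kNv].
  rewrite (big_fsetD1 k) //= eqxx big1_fset ?addr0 // => l.
  by rewrite in_fsetD1 => /andP[/negPf-> _].
rewrite big1_fset => [|l lv _]; first by rewrite mcoeff_outdom // mulr0.
by case: eqP => // lk; rewrite -lk lv in kNv.
Qed.

(** Otherwise [y] and [z] have the same product with every vector, in
    particular with [y - z], which is then isotropic. *)
Lemma cartan_separates (y z : 'rV[int]_n) : y != z ->
  exists i, cip (delta_mx 0 i) (cvec y) != cip (delta_mx 0 i) (cvec z).
Proof.
move=> yz; apply: contrapT => /forallNP eqi.
have yzE h : cip h (cvec y) = cip h (cvec z).
  rewrite cip_suml [RHS]cip_suml; apply: eq_bigr => i _; congr (_ * _).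
  by apply/eqP/negPn/negP; exact: eqi.
move: (yzE (cvec (y - z))); rewrite !cip_cvec => -[] lipE.
have := lip_eq0 ip b b_basis (y - z).
rewrite lipDr lipNr lipE subrr => /(_ erefl) /eqP.
by rewrite subr_eq0 (negPf yz).
Qed.

(** A Cartan vector whose eigenvalues on [<< k >>] and [<< l >>] differ
    makes it possible to remove [l] from the support of a vector while keeping
    [k].  Since only one weight-one basis vector has the nonzero degree [k.2],
    the support shrinks to [k] alone. *)
Lemma isolate_root_vector (t : set VL) : is_subspace t ->
  (forall i v, t v -> t (bracket << cartan_key i >> v)) ->
  forall v k, t v -> supported W1 v -> k \in msupp v -> k.2 != 0 -> t << k >>.
Proof.
move=> tS tcartan v k; move: {2}(#|` msupp v|) (leqnn #|` msupp v|) => N.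
elim: N v => [|N IHN] v.
  by rewrite leqn0 cardfs_eq0 => /eqP-> _ _; rewrite in_fset0.
move=> vN tv v1 kv k0.
have [[l [lv lk]]|lNk] := pselect (exists l, l \in msupp v /\ l <> k); last first.
  apply: (subspaceZ_iff _ (v@_k) _ tS); first by rewrite mcoeff_neq0.
  suff <- : v = v@_k *: << k >> by [].
  apply/malgP => l; rewrite [RHS]mcoeffZ [X in _ * X]mcoeffU.
  case: eqP => [<-|kl]; first by rewrite mulr1.
  rewrite mulr0 mcoeff_outdom //; apply/negP => lv; apply: lNk.
  by exists l; split => // lk; apply: kl.
have lk2 : k.2 != l.2.
  apply/eqP => kl2; apply: lk.
  have [[Al _]|[i li]] := weight_one_key _ _ b_basis L_even _ (v1 l lv); last first.
    by rewrite kl2 li eqxx in k0.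
  have [[Ak _]|[i ki]] := weight_one_key _ _ b_basis L_even _ (v1 k kv); last first.
    by rewrite ki eqxx in k0.
  by case: (k) (l) kl2 Al Ak => [A x] [A' x'] /= -> -> ->.
have [i kli] := cartan_separates _ _ lk2.
(* [w] is [v] acted upon by the Cartan vector minus its eigenvalue on [l]. *)
pose c (m : key) := cip (delta_mx 0 i) (cvec m.2) - cip (delta_mx 0 i) (cvec l.2).
pose w : VL := (- cip (delta_mx 0 i) (cvec l.2)) *: v + bracket << cartan_key i >> v.
have wE m : w@_m = c m * v@_m.
  rewrite /w mcoeffD [X in X + _]mcoeffZ (bracket_cartan _ _ _ eps_cocycle).
  rewrite [X in _ + X](mcoeff_lin_extend_diag (fun m => cip (delta_mx 0 i) (cvec m.2))).
  by rewrite -mulrDl addrC.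
have wv : {subset msupp w <= msupp v}.
  by move=> m; rewrite -!mcoeff_neq0 wE mulf_eq0 negb_or => /andP[].
apply: (IHN w).
- rewrite -ltnS; apply: leq_trans vN; apply: fproper_ltn_card.
  rewrite fproperE; apply/andP; split; first exact/fsubsetP.
  apply/fsubsetPn; exists l => //.
  by rewrite -mcoeff_eq0 wE /c subrr mul0r.
- by case: (tS) => _; apply => //; exact: tcartan.
- by move=> m /wv /v1.
- by rewrite -mcoeff_neq0 wE mulf_neq0 ?mcoeff_neq0 // subr_eq0.
- by [].
Qed.

Lemma eps_neq0 x y : (eps x y)%:~R != 0 :> C.
Proof. by have [H _ _ _] := eps_cocycle; case: (H x y) => ->; rewrite intr_eq0. Qed.

Lemma not_solvable_opposite_roots (t : set VL) (x : 'rV[int]_n) :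
  is_subalgebra bracket (supported W1) t -> lip x x = 2 ->
  t << root_key x >> -> t << root_key (- x) >> -> ~ is_solvable bracket t.
Proof.
move=> [_ tS tbr] x2 te tf.
have Nx2 : lip (- x) (- x) = 2 by rewrite lipNl lipNr opprK.
have ef := bracket_rootsN2 _ _ eps b_basis L_even _ x2 _ Nx2 erefl.
have th : t (cartan_vec (cvec x)).
  by have := tbr _ _ te tf; rewrite ef; apply: (subspaceZ_iff _ _ _ tS (eps_neq0 x (- x))).
have e0 : << root_key x >> != 0 :> VL by rewrite monalgU_eq0 oner_eq0.
have two0 : 2%:C != 0 :> C by rewrite fmorph_eq0 pnatr_eq0.
have h_eigen k : bracket (cartan_vec (cvec x)) << k >> = (lip x k.2)%:C *: << k >>.
  by rewrite -cip_cvec; exact: (bracket_cartan_vec _ _ _ eps_cocycle).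
have he := h_eigen (root_key x); rewrite x2 in he.
have hf := h_eigen (root_key (- x)); rewrite lipNr x2 rmorphN in hf.
apply: (not_solvable_sl2 _ _ _ _ _ _ te tf th e0 two0 he hf).
by exists (eps x (- x))%:~R; [exact: eps_neq0 | exact: ef].
Qed.

Lemma borel_sub_voa_borel (B : set 'rV[int]_n) : borel_type ip b B ->
  is_borel_subalgebra bracket (weight_one ip b (sub_voa setT)) (weight_one ip b (sub_voa B)).
Proof.
move=> B_borel; have [B_monoid /seteqP[_ B_total] _ _] := B_borel.
split; first exact: (sub_voa_subalgebra _ _ _ b_basis L_even eps_cocycle).
  rewrite weight_one_sub_voa; exact: (borel_solvable _ _ _ b_basis L_even eps_cocycle).
move=> t; rewrite !weight_one_sub_voa => t_alg t_solv Bt.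
have [tg tS tbr] := t_alg.
have t1 : t `<=` supported W1.
  by move=> v /tg; apply: supported_sub; exact: keys_over_W1.
apply/seteqP; split => // v tv k kv.
have k1 : W1 k by exact: t1 kv.
split => //; apply: contrapT => Bk.
have k0 : k.2 != 0 by apply/eqP => k0; apply: Bk; rewrite k0; case: B_monoid.
have [//|[x Bx xk]] := B_total k.2 I.
have [[Ak kk]|[i ki]] := weight_one_key _ _ b_basis L_even _ k1; last first.
  by rewrite ki eqxx in k0.
have x2 : lip x x = 2 by rewrite -kk -xk lipNl lipNr opprK.
have kE : k = root_key (- x).
  by case: (k) Ak xk => A y /= -> <-.
apply: (not_solvable_opposite_roots t x) t_solv => //.
- by apply: Bt; apply: supported_basis; split => //; exact: root_key_weight.
- rewrite -kE; apply: (isolate_root_vector t tS _ v) => //; last exact: t1.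
  move=> i w tw; apply: tbr => //; apply: Bt; apply: supported_basis.
  by split; [case: B_monoid | exact: weight_cartan_key].
Qed.

End Maximality.

Theorem proposition4p1 (R : realType) (E : vectType R)
    (ip : {dot E for @idfun R}) (n : nat) (b : n.-tuple E)
    (eps : 'rV[int]_n -> 'rV[int]_n -> int)
    (b_basis : basis_of fullv b)
    (L_even : even_lattice ip b)
    (eps_cocycle : lattice_cocycle ip b eps)
    (roots_nonempty : lattice_roots ip b !=set0) :
  (forall P : set 'rV[int]_n, parabolic_type ip b P ->
     is_parabolic_subalgebra (zero_bracket ip b eps)
       (weight_one ip b (sub_voa [set: 'rV[int]_n]))
       (weight_one ip b (sub_voa P)))
  /\
  (forall B : set 'rV[int]_n, borel_type ip b B ->
     is_borel_subalgebra (zero_bracket ip b eps)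
       (weight_one ip b (sub_voa [set: 'rV[int]_n]))
       (weight_one ip b (sub_voa B))).
Proof.
have borel := borel_sub_voa_borel ip b eps b_basis L_even eps_cocycle.
split => // P [P_monoid [B B_borel BP]]; split.
  exact: (sub_voa_subalgebra _ _ _ b_basis L_even eps_cocycle).
exists (weight_one ip b (sub_voa B)); first exact: borel.
by move=> v [Bv v1]; split => // k /Bv /BP.
Qed.
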